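(* Let $q=2^{2m+1}$. Then $q^2-4\leqslant\mathrm{Cr}_{q^2+1}(\mathrm{Sz}(q))\leqslant q^2-2$. Moreover, for the field automorphism $h$ defined below, $d_{q^2+1}(h,\mathrm{Sz}(q))=q^2-4$.
   Context: For $n\geqslant 2$, the Hamming distance on the symmetric group $\mathrm{S}_n$ is $d_n(g,h)=n-|\mathrm{fix}(gh^{-1})|$, where $\mathrm{fix}(x)$ is the set of fixed points of $x$. For a subset $C\subseteq \mathrm{S}_n$ and $v\in\mathrm{S}_n$, $d_n(v,C)=\min\{d_n(v,c)\mid c\in C\}$, and the covering radius of $C$ is $\mathrm{Cr}_n(C)=\max\{d_n(v,C)\mid v\in\mathrm{S}_n\}$. Let $q=2^{2m+1}$, $\ell=2^{m+1}$, and $\Omega=\{(a,b,c)\in\mathbb{F}_q^3\mid c=ab+a^{\ell+2}+b^\ell\}\cup\{\infty\}$, so $|\Omega|=q^2+1$, on which the Suzuki group $\mathrm{Sz}(q)$ acts $2$-transitively. The permutation $h$ of $\Omega$ is defined by $\infty^h=\infty$ and $(a,b,c)^h=(a^2,b^2,c^2)$ for $(a,b,c)\in\mathbb{F}_q^3$. *)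

(* Defs.v *)
From HB Require Import structures.
From mathcomp Require Import all_boot all_order all_algebra all_fingroup all_solvable all_field.
From mathcomp Require Import ring.

Set Implicit Arguments.
Unset Strict Implicit.
Unset Printing Implicit Defensive.

Import GRing.Theory.

Section Covering.
Variable T : finType.
Implicit Types (g h v : {perm T}) (C : {set {perm T}}).

Definition hamming_dist g h : nat := #|T| - #|'Fix_'P[g * h^-1]%g|.

(* hamming_dist is bounded by #|T|, so for nonempty C this is the minimum of
   hamming_dist v c over c \in C. *)
Definition dist_to v C : nat := \big[minn/#|T|]_(c in C) hamming_dist v c.

Definition covering_radius C : nat := \max_(v : {perm T}) dist_to v C.

End Covering.

Definition suzuki_q (m : nat) : nat := 2 ^ (2 * m + 1).
Definition suzuki_l (m : nat) : nat := 2 ^ (m + 1).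

Local Open Scope ring_scope.

(* Points are triples over F, with None standing for the point at infinity. *)
Definition on_ovoid (m : nat) (F : finFieldType) (p : option (F * F * F)) : bool :=
  if p is Some (a, b, c) then
    c == a * b + a ^+ (suzuki_l m + 2) + b ^+ suzuki_l m
  else true.

Definition ovoid (m : nat) (F : finFieldType) : finType :=
  {p : option (F * F * F) | on_ovoid m p}.

Section Maps.
Variables (m : nat) (F : finFieldType).
Local Notation l := (suzuki_l m).
Local Notation point := (option (F * F * F)).

Definition trans_fun (u v : F) (p : point) : point :=
  if p is Some (a, b, c) then
    Some (a + u,
          b + v + u ^+ l * a,
          c + u * v + u ^+ (l + 2) + v ^+ l + u * b + u ^+ (l + 1) * a + v * a)
  else None.

Definition diag_fun (k : F) (p : point) : point :=
  if p is Some (a, b, c) then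
    Some (k * a, k ^+ (l + 1) * b, k ^+ (l + 2) * c)
  else None.

(* On the ovoid, c = 0 only at (0, 0, 0). *)
Definition inv_fun (p : point) : point :=
  if p is Some (a, b, c) then
    if c == 0 then None else Some (b / c, a / c, c^-1)
  else Some (0, 0, 0).

Definition frob_fun (p : point) : point :=
  if p is Some (a, b, c) then Some (a ^+ 2, b ^+ 2, c ^+ 2) else None.

End Maps.

Section OvoidPerm.
Variables (m : nat) (F : finFieldType).
Variable f : option (F * F * F) -> option (F * F * F).
Hypothesis f_stable : forall p, on_ovoid m p -> on_ovoid m (f p).
Hypothesis f_inj : {in @on_ovoid m F &, injective f}.

Definition ovoid_fun (x : ovoid m F) : ovoid m F :=
  exist _ (f (val x)) (f_stable (valP x)).

Lemma ovoid_fun_inj : injective ovoid_fun.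
Proof.
move=> x y /(congr1 val) /= fxy; apply/val_inj.
by apply: f_inj fxy; [exact: valP x | exact: valP y].
Qed.

Definition ovoid_perm : {perm ovoid m F} := perm ovoid_fun_inj.

Lemma val_ovoid_perm x : val (ovoid_perm x) = f (val x).
Proof. by rewrite permE. Qed.

End OvoidPerm.

Section Suzuki.
Variables (m : nat) (F : finFieldType).
Hypothesis cardF : #|F| = suzuki_q m.
Local Notation l := (suzuki_l m).
Local Notation point := (option (F * F * F)).

Lemma suzuki_pchar : 2%N \in [pchar F].
Proof. exact: (card_finPcharP cardF). Qed.

Let two0 : 2%:R = 0 :> F.
Proof. exact: pcharf0 suzuki_pchar. Qed.

Let add_id (x y : F) : x + y = 0 -> x = y.
Proof. by move/eqP; rewrite addr_eq0 (oppr_pchar2 suzuki_pchar) => /eqP. Qed.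

Lemma expr_l_l (x : F) : (x ^+ l) ^+ l = x ^+ 2.
Proof.
rewrite -exprM -expnD; have -> : (m + 1 + (m + 1) = (2 * m + 1) + 1)%N by ring.
by rewrite expnD exprM -/(suzuki_q m) -cardF expf_card.
Qed.

Lemma exprD_l (x y : F) : (x + y) ^+ l = x ^+ l + y ^+ l.
Proof.
by rewrite exprDn_pchar // pnatX (pnatE _ (isT : prime 2)) suzuki_pchar.
Qed.

Lemma expr0_l : (0 : F) ^+ l = 0.
Proof. by rewrite expr0n expn_eq0. Qed.

Lemma expr_l_eq0 (x : F) : x ^+ l = 0 -> x = 0.
Proof. by move/eqP; rewrite expf_eq0 => /andP[_ /eqP]. Qed.

Lemma ovoid_c0 (a b : F) :
  0 = a * b + a ^+ (l + 2) + b ^+ l -> a = 0 /\ b = 0.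
Proof.
rewrite exprD => e0.
have eB : b ^+ l = a * b + a ^+ l * a ^+ 2 by apply: add_id; rewrite addrC -e0.
have e1 : a ^+ l * b ^+ l + a ^+ 2 * (a ^+ l) ^+ 2 + b ^+ 2 = 0.
  have := congr1 (fun x => x ^+ l) e0.
  rewrite /= !exprD_l !exprMn !expr_l_l expr0_l => e.
  by rewrite [RHS]e; ring.
have : b * (a ^+ l * a + b) = 0.
  rewrite -[RHS]e1 eB.
  transitivity (b * (a ^+ l * a + b) + 2%:R * (a ^+ 2 * (a ^+ l) ^+ 2)).
    by rewrite two0 mul0r addr0.
  by ring.
have l_eq0 (x : F) : x ^+ l * x ^+ 2 = 0 -> x = 0.
  by rewrite -exprD => /eqP; rewrite expf_eq0 => /andP[_ /eqP].
move/eqP; rewrite mulf_eq0 => /orP[/eqP b0 | /eqP /add_id bE].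
  split=> //; apply: l_eq0; move: e0.
  by rewrite b0 mulr0 add0r expr0_l addr0.
have b0 : b = 0.
  apply: expr_l_eq0; rewrite eB -bE.
  transitivity (2%:R * (a ^+ l * a ^+ 2)); first by ring.
  by rewrite two0 mul0r.
split=> //; apply: l_eq0.
by rewrite expr2 mulrA bE b0 mul0r.
Qed.

Lemma trans_stable u v (p : point) : on_ovoid m p -> on_ovoid m (trans_fun m u v p).
Proof.
case: p => [[[a b] c]|] //= /eqP ->; apply/eqP.
rewrite !exprD !exprD_l exprMn expr_l_l !expr1.
set U := u ^+ l; set V := v ^+ l; set A := a ^+ l; set B := b ^+ l.
transitivity (a * b + A * a ^+ 2 + B + u * v + U * u ^+ 2 + V + u * b
    + U * u * a + v * a
    + 2%:R * (U * a ^+ 2 + A * u ^+ 2 + u * a * (A + U))).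
  by rewrite two0 mul0r addr0.
by ring.
Qed.

Lemma trans_inj u v : {in @on_ovoid m F &, injective (trans_fun m u v)}.
Proof.
move=> [[[a b] c]|] [[[a' b'] c']|] _ _ //= [].
by move=> /addIr -> /addIr/addIr -> /addIr/addIr/addIr/addIr/addIr/addIr ->.
Qed.

Lemma diag_stable k (p : point) : on_ovoid m p -> on_ovoid m (diag_fun m k p).
Proof.
case: p => [[[a b] c]|] //= /eqP ->; apply/eqP.
rewrite !(exprD, exprMn) expr_l_l !expr1; by ring.
Qed.

Lemma diag_inj k : k != 0 -> {in @on_ovoid m F &, injective (diag_fun m k)}.
Proof.
move=> k0 [[[a b] c]|] [[[a' b'] c']|] _ _ //= [].
by move=> /(mulfI k0) -> /(mulfI (expf_neq0 _ k0)) -> /(mulfI (expf_neq0 _ k0)) ->.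
Qed.

Lemma inv_stable (p : point) : on_ovoid m p -> on_ovoid m (inv_fun p).
Proof.
case: p => [[[a b] c]|] /=; last first.
  by rewrite mul0r exprD expr0_l !mul0r !addr0.
move=> /eqP cE; case: eqP => //= /eqP c0; apply/eqP.
have C0 : c ^+ l != 0 by rewrite expf_neq0.
have cl : c ^+ l = a ^+ l * b ^+ l + a ^+ 2 * (a ^+ l) ^+ 2 + b ^+ 2.
  rewrite cE !exprD !exprD_l !exprMn !expr_l_l; by ring.
have key : c * c ^+ l = a * b * c ^+ l + b ^+ l * b ^+ 2 + a ^+ l * c ^+ 2.
  have c2 : c ^+ 2 = a ^+ 2 * b ^+ 2 + (a ^+ l) ^+ 2 * a ^+ 4 + (b ^+ l) ^+ 2.
    rewrite {1}cE exprD.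
    transitivity (a ^+ 2 * b ^+ 2 + (a ^+ l) ^+ 2 * a ^+ 4 + (b ^+ l) ^+ 2
      + 2%:R * (a * b * a ^+ l * a ^+ 2 + a * b * b ^+ l + a ^+ l * a ^+ 2 * b ^+ l)).
      by ring.
    by rewrite two0 mul0r addr0.
  rewrite c2 {1}cE exprD cl.
  set A := a ^+ l; set B := b ^+ l.
  transitivity (a * b * (A * B + a ^+ 2 * A ^+ 2 + b ^+ 2) + B * b ^+ 2
     + A * (a ^+ 2 * b ^+ 2 + A ^+ 2 * a ^+ 4 + B ^+ 2)
     + 2%:R * (A ^+ 2 * a ^+ 2 * B)); first by ring.
  by rewrite two0 mul0r addr0.
rewrite !exprD !exprMn !exprVn.
transitivity ((c * c ^+ l) / (c ^+ 2 * c ^+ l)).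
  by field; rewrite c0 C0.
rewrite key; by field; rewrite c0 C0.
Qed.

Lemma inv_funK : {in @on_ovoid m F, cancel (@inv_fun F) (@inv_fun F)}.
Proof.
move=> [[[a b] c]|]; last by rewrite /= eqxx.
rewrite unfold_in /=; case: (eqVneq c 0) => [-> /eqP /ovoid_c0[-> ->] // | c0 _ /=].
by rewrite invr_eq0 (negbTE c0) invrK !divfK.
Qed.

Lemma inv_inj : {in @on_ovoid m F &, injective (@inv_fun F)}.
Proof. exact: can_in_inj inv_funK. Qed.

Lemma frob_stable (p : point) : on_ovoid m p -> on_ovoid m (frob_fun p).
Proof.
have D (x y : F) : (x + y) ^+ 2 = x ^+ 2 + y ^+ 2.
  by rewrite sqrrD -mulr_natl two0 mul0r addr0.
case: p => [[[a b] c]|] //= /eqP ->; apply/eqP.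
by rewrite !D exprMn (exprAC a _ 2%N) (exprAC b _ 2%N).
Qed.

Lemma frob_inj : {in @on_ovoid m F &, injective (@frob_fun F)}.
Proof.
have I (x y : F) : x ^+ 2 = y ^+ 2 -> x = y.
  move/eqP; rewrite eqf_sqr (oppr_pchar2 suzuki_pchar) orbb; exact/eqP.
move=> [[[a b] c]|] [[[a' b'] c']|] _ _ //= [].
by move=> /I -> /I -> /I ->.
Qed.

Lemma card_ovoid : #|ovoid m F| = (suzuki_q m ^ 2 + 1)%N.
Proof.
pose g (x : option (F * F)) : option (F * F * F) :=
  if x is Some (a, b) then Some (a, b, a * b + a ^+ (l + 2) + b ^+ l) else None.
have gP x : on_ovoid m (g x) by case: x => [[a b]|] /=.
pose g' (x : ovoid m F) : option (F * F) :=
  if val x is Some (a, b, _) then Some (a, b) else None.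
have gK : cancel (fun x => exist _ (g x) (gP x) : ovoid m F) g' by case=> [[]|].
have g'K : cancel g' (fun x => exist _ (g x) (gP x) : ovoid m F).
  move=> [[[[a b] c]|] i] //=; apply/val_inj => //=.
  by rewrite -(eqP i).
rewrite -(bij_eq_card (Bijective gK g'K)) card_option card_prod cardF.
by rewrite addn1.
Qed.

Definition trans_perm (u v : F) : {perm ovoid m F} :=
  ovoid_perm (trans_stable u v) (@trans_inj u v).

Lemma unit_neq0 (k : {unit F}) : FinRing.uval k != 0.
Proof. by rewrite -unitfE; exact: valP k. Qed.

Definition diag_perm (k : {unit F}) : {perm ovoid m F} :=
  ovoid_perm (diag_stable (FinRing.uval k)) (diag_inj (unit_neq0 k)).

Definition inv_perm : {perm ovoid m F} := ovoid_perm inv_stable inv_inj.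

(* The Suzuki group in its 2-transitive representation on the ovoid, by the
   standard generators (Dixon and Mortimer, Permutation Groups, Section 7.7):
   the stabiliser of infinity consists of the products of a trans_perm and a
   diag_perm, and inv_perm swaps infinity and (0, 0, 0). *)
Definition suzuki_group : {group {perm ovoid m F}} :=
  <<[set trans_perm u v | u : F, v : F]
    :|: [set diag_perm k | k : {unit F}]
    :|: [set inv_perm]>>%G.

Definition frob_perm : {perm ovoid m F} := ovoid_perm frob_stable frob_inj.

End Suzuki.

(* Main.v *)
Require Import Defs.
From mathcomp Require Import all_boot all_order all_algebra all_fingroup all_solvable all_field.
From mathcomp Require Import ring zify.

Set Implicit Arguments.
Unset Strict Implicit.
Unset Printing Implicit Defensive.

Import GRing.Theory.

(** Upper bound: let [f g] count the points where [v] and [g] agree, and suppose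
    [f <= 2] on the group. The translations form a group of order [q^2] acting
    regularly on the points other than infinity. Summing [f] over the
    translates of [g] gives [2 q^2] if [v] and [g] agree at infinity, which forces
    [f g = 2], hence, by transitivity, [f] only takes the values 0 and 2. If [v]
    and [g] disagree at infinity, the sum is [q^2 - 1], which is odd.

    Distance of the Frobenius map: in homogeneous coordinates the group acts on
    the ovoid by similitudes of a symplectic form on [F^4], under which distinct
    points of the ovoid are never orthogonal, while the Frobenius map squares
    the form. Comparing the two at six points of agreement gives six vectors
    with pairwise products 1, whose Gram matrix is invertible in characteristic
    2: impossible in dimension 4. The identity agrees at infinity and at the
    four points over the prime field. *)

(** * Counting agreements over a set acting regularly away from one point *)

Section Agreement.
Variable T : finType.
Implicit Types (g v k : {perm T}) (x y : T).

Definition agreement v g : {set T} := [set x | v x == g x].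

Lemma hamming_distE v g : hamming_dist v g = #|T| - #|agreement v g|.
Proof.
congr (_ - _); apply: eq_card => x; rewrite [in RHS]inE.
apply/afix1P/eqP => [vgx | vgx]; last by rewrite /= apermE permM vgx permK.
by rewrite -{2}vgx /= apermE permM permKV.
Qed.

(** Serves to move a point of agreement to [o]. *)
Lemma card_agreement_mull k v g : #|agreement (k * v)%g (k * g)%g| = #|agreement v g|.
Proof.
rewrite -[RHS](card_preimset _ (@perm_inj _ k)).
by apply: eq_card => x; rewrite !inE !permM.
Qed.

Lemma dist_to_le v g (C : {set {perm T}}) : g \in C -> dist_to v C <= hamming_dist v g.
Proof.
exact: (@Order.TotalTheory.bigmin_le_cond _ nat _ #|T| g (mem C) (hamming_dist v)).
Qed.

(** The bound [n <= #|T|] handles the default value of the minimum. *)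
Lemma leq_dist_to n v (C : {set {perm T}}) :
  n <= #|T| -> {in C, forall g, n <= hamming_dist v g} -> n <= dist_to v C.
Proof.
move=> nT nC; rewrite /dist_to; elim/big_ind: _ => // a b na nb.
by rewrite leq_min na.
Qed.

Variables (G : {group {perm T}}) (A : {set {perm T}}) (o : T).
Hypothesis transG : forall x, exists2 g, g \in G & g o = x.
Hypothesis sAG : A \subset G.
Hypothesis A1 : 1%g \in A.
Hypothesis cardT : #|T| = #|A|.+1.
Hypothesis evenA : ~~ odd #|A|.
Hypothesis fixA : {in A, forall t : {perm T}, t o = o}.
Hypothesis regA : forall x y, x != o -> y != o -> #|[set t in A | t x == y]| = 1.

(** Pairs [(t, x)] with [v x = g (t x)] are counted by [x]. A point other than [o] lies in one pair,
    or in none if [v x = g o]; the point [o] lies in [#|A|] pairs or in none. *)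
Lemma sum_agreement v g :
  \sum_(t in A) #|agreement v (t * g)%g| =
  if v o == g o then #|A| + #|A| else #|A|.-1.
Proof.
have cA x : x != o -> #|[set t in A | g (t x) == v x]| = (v x != g o).
  move=> xo; set y := (g^-1 (v x))%g.
  have vgy : v x = g y by rewrite permKV.
  rewrite vgy (inj_eq perm_inj); have [yo | yo] := eqVneq y o.
    apply/eqP; rewrite cards_eq0; apply/eqP/setP => t; rewrite !inE.
    rewrite (inj_eq perm_inj) yo; apply/negP => /andP[At /eqP tx].
    by case/eqP: xo; apply: (@perm_inj _ t); rewrite tx fixA.
  rewrite -[RHS](regA xo yo); apply: eq_card => t.
  by rewrite !inE (inj_eq perm_inj).
transitivity (\sum_x #|[set t in A | g (t x) == v x]|).
  transitivity (\sum_(t in A) \sum_x (g (t x) == v x : nat)).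
    apply: eq_bigr => t _; rewrite -sum1dep_card big_mkcond /=.
    by apply: eq_bigr => x _; rewrite permM eq_sym; case: eqP.
  rewrite exchange_big; apply: eq_bigr => x _ /=.
  rewrite -sum1dep_card big_mkcondr /=.
  by apply: eq_bigr => t _; case: eqP.
rewrite (bigD1 o) //= (eq_bigr (fun x => (v x != g o) : nat)) //.
have -> : #|[set t in A | g (t o) == v o]| = #|A| * (v o == g o).
  case: eqVneq => [vg | vg].
    rewrite muln1; apply: eq_card => t; rewrite !inE.
    by case At: (t \in A) => //; rewrite fixA // vg eqxx.
  rewrite muln0; apply/eqP; rewrite cards_eq0; apply/eqP/setP => t; rewrite !inE.
  by apply/negP => /andP[At]; rewrite fixA // eq_sym (negPf vg).
set S := \sum_(i | _) _.
(* The added term is that of [o]; over all points, only the preimage of [g o] under [v] contributes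
   0. *)
have : S + (v o != g o) = #|A|.
  rewrite /S addnC.
  transitivity (\sum_x ((v x != g o) : nat)); first by rewrite [RHS](bigD1 o).
  transitivity #|predC (pred1 (v^-1 (g o))%g)|.
    rewrite -sum1_card [RHS]big_mkcond /=; apply: eq_bigr => x _.
    by rewrite !inE (canF_eq (permK v)); case: eqP.
  by have := cardC (pred1 (v^-1 (g o))%g); rewrite card1 cardT add1n => -[].
by case: (v o == g o) => /=; lia.
Qed.

Lemma agreement_all2 v :
  {in G, forall g, #|agreement v g| <= 2} ->
  {in G, forall g, v o = g o -> #|agreement v g| = 2}.
Proof.
move=> le2 g gG vg; have := sum_agreement v g; rewrite vg eqxx => sumE.
have le2A t : t \in A -> #|agreement v (t * g)%g| <= 2 ?= iff (#|agreement v (t * g)%g| == 2).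
  by move=> At; split=> //; apply: le2; rewrite groupM // (subsetP sAG).
have [_ ] := leqif_sum le2A; rewrite sumE sum_nat_const muln2 addnn eqxx.
by move/esym/forall_inP/(_ _ A1)/eqP; rewrite mul1g.
Qed.

Lemma exists_agreement3 v : exists2 g, g \in G & 3 <= #|agreement v g|.
Proof.
apply/exists_inP; apply: contraT; rewrite negb_exists_in => /forall_inP lt3.
have le2 : {in G, forall g, #|agreement v g| <= 2}.
  by move=> g /lt3; rewrite -ltnNge.
(* If there is a point of agreement, an element [k] of the group taking [o] to it reduces to
   agreement at [o], where the count is 2. *)
have ev g : g \in G -> ~~ odd #|agreement v g|.
  move=> gG; have [-> | [x]] := set_0Vmem (agreement v g); first by rewrite cards0.
  rewrite inE => /eqP vgx; have [k kG ko] := transG x.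
  rewrite -(card_agreement_mull k) (@agreement_all2 (k * v)%g) ?groupM //.
    move=> g' g'G; rewrite -(mulKVg k g') card_agreement_mull.
    by apply: le2; rewrite groupM ?groupV.
  by rewrite !permM ko.
(* [T] has at least two points, so transitivity yields a [g] disagreeing with [v] at [o]. *)
have [x xo] : exists x, x != v o.
  apply/existsP; apply: contraT; rewrite negb_exists => /forallP allv.
  have : #|T| <= 1.
    apply/card_le1_eqP => x y _ _; move: (allv x) (allv y).
    by rewrite !negbK => /eqP-> /eqP->.
  by rewrite cardT ltnS leqn0 cards_eq0 => /eqP A0; move: A1; rewrite A0 inE.
have [g gG go] := transG x.
have := sum_agreement v g; rewrite go eq_sym (negPf xo) => sumE.
have : ~~ odd (\sum_(t in A) #|agreement v (t * g)%g|).
  elim/big_ind: _ => // [a b | t At]; first by rewrite oddD => /negPf-> /negPf->.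
  by apply: ev; rewrite groupM // (subsetP sAG).
(* Positivity keeps [#|A|.-1] from being truncated, so that it is odd. *)
have : 0 < #|A| by apply/card_gt0P; exists 1%g.
by rewrite sumE; move: evenA; lia.
Qed.

Lemma covering_radius_le : covering_radius G <= #|T| - 3.
Proof.
apply/bigmax_leqP => v _; have [g gG le3] := exists_agreement3 v.
by apply: leq_trans (dist_to_le v gG) _; rewrite hamming_distE leq_sub2l.
Qed.

End Agreement.

Local Open Scope ring_scope.

Section SymplecticForm.
Variables (m : nat) (F : finFieldType).
Hypothesis cardF : #|F| = suzuki_q m.
Local Notation l := (suzuki_l m).
Local Notation point := (option (F * F * F)).
Local Notation omega := (ovoid m F).

Let two0 : 2%:R = 0 :> F.
Proof. exact: pcharf0 (suzuki_pchar cardF). Qed.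

Let addxx (x : F) : x + x = 0.
Proof. by rewrite -mulr2n -mulr_natl two0 mul0r. Qed.

Let addr_eq0P (x y : F) : x + y = 0 -> x = y.
Proof. by move/eqP; rewrite addr_eq0 (oppr_pchar2 (suzuki_pchar cardF)) => /eqP. Qed.

(* Homogeneous coordinates in PG(3, q). *)
Definition coord (p : point) : seq F :=
  if p is Some (a, b, c) then [:: 1; a; b; c] else [:: 0; 0; 0; 1].

(** The antidiagonal Gram matrix gives an alternating form in characteristic 2. *)
Definition form (p p' : point) : F :=
  \sum_(i < 4) (coord p)`_i * (coord p')`_(rev_ord i).

Lemma form_fin a b c a' b' c' :
  form (Some (a, b, c)) (Some (a', b', c')) = c' + a * b' + b * a' + c.
Proof. by rewrite /form !big_ord_recl big_ord0 /= mul1r mulr1 addr0 !addrA. Qed.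

Lemma form_fin_inf a b c : form (Some (a, b, c)) None = 1.
Proof. by rewrite /form !big_ord_recl big_ord0 /= !mulr0 mul1r !addr0. Qed.

Lemma form_inf_fin a b c : form None (Some (a, b, c)) = 1.
Proof. by rewrite /form !big_ord_recl big_ord0 /= !mul0r mul1r !add0r addr0. Qed.

Lemma form_xx p : form p p = 0.
Proof.
case: p => [[[a b] c]|]; last first.
  by rewrite /form !big_ord_recl big_ord0 /= !mul0r !mulr0 !addr0.
by rewrite form_fin (mulrC b) -(addrA c) addxx addr0 addxx.
Qed.

Definition formE := (form_fin, form_fin_inf, form_inf_fin, form_xx).

(* The point (a, b) is translated to the origin, where [ovoid_c0] applies. *)
Lemma form_eq0 (p p' : point) :
  on_ovoid m p -> on_ovoid m p' -> form p p' = 0 -> p = p'.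
Proof.
case: p => [[[a b] c]|]; case: p' => [[[a' b'] c']|] //=; last 2 first.
- by rewrite form_fin_inf => _ _ /eqP; rewrite oner_eq0.
- by rewrite form_inf_fin => _ _ /eqP; rewrite oner_eq0.
move=> /eqP cE /eqP c'E; rewrite form_fin cE c'E => f0.
have [] := @ovoid_c0 m F cardF (a + a') (b + b' + a ^+ l * (a + a')).
  rewrite -[LHS]f0 !exprD !exprD_l // exprMn exprD_l // expr_l_l //.
  set A := a ^+ l; set A' := a' ^+ l.
  transitivity (a' * b' + A' * a' ^+ 2 + b' ^+ l + a * b' + b * a'
    + (a * b + A * a ^+ 2 + b ^+ l)); first by ring.
  rewrite -[LHS]addr0 -(mul0r (A * (a + a') ^+ 2 + A' * a ^+ 2 + A' * a * a')) -two0.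
  by ring.
move=> /addr_eq0P aE; rewrite aE addxx mulr0 addr0 => /addr_eq0P bE.
by rewrite bE.
Qed.

(** [k] absorbs both the rescaling of [coord] at each point and a square root of the multiplier.
    Finite functions make the property boolean. *)
Definition similitude (g : {perm omega}) : bool :=
  [exists k : {ffun omega -> F}, [forall x, k x != 0] &&
    [forall x, forall y,
      form (val (g x)) (val (g y)) == k x * k y * form (val x) (val y)]].

Lemma similitudeP (g : {perm omega}) : reflect
  (exists2 k : omega -> F, forall x, k x != 0 &
     forall x y, form (val (g x)) (val (g y)) = k x * k y * form (val x) (val y))
  (similitude g).
Proof.
apply: (iffP existsP) => [[k /andP[/forallP k0 /forallP kE]] | [k k0 kE]].
  by exists k => // x y; apply/eqP; exact: (forallP (kE x) y).
exists (finfun k); apply/andP; split; first by apply/forallP => x; rewrite ffunE.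
by apply/forallP => x; apply/forallP => y; rewrite !ffunE kE.
Qed.

Lemma similitude_trans u v : similitude (trans_perm cardF u v).
Proof.
apply/similitudeP; exists (fun=> 1) => [x|x y]; first exact: oner_neq0.
rewrite !mul1r !val_ovoid_perm.
case: (val x) (val y) => [[[a b] c]|] [[[a' b'] c']|] //=; rewrite !formE //.
rewrite !exprD expr1; set U := u ^+ l; set V := v ^+ l.
(* Surplus terms come in pairs; adding their half-sum times 2 gives an identity valid in any
   commutative ring. *)
rewrite -[RHS]addr0 -(mul0r (u * v *+ 2 + U * u ^+ 2 + V + U * u * a + U * u * a' + u * b + u * b' +
   v * a + v * a' + U * a * a')) -two0.
by ring.
Qed.

Lemma similitude_diag k : similitude (diag_perm cardF k).
Proof.
set z := FinRing.uval k; have z0 : z != 0 := unit_neq0 k.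
(* A square root of the multiplier [z ^+ (l + 2)]. Infinity gets [r^-1], since its product with a
   finite point stays 1. *)
pose r := z ^+ (2 ^ m + 1); have r0 : r != 0 by rewrite expf_neq0.
have rr : r * r = z ^+ (l + 2).
  rewrite -exprD; congr (_ ^+ _); rewrite /suzuki_l expnD expn1; lia.
apply/similitudeP; exists (fun x => if val x is Some _ then r else r^-1).
  by move=> x; case: (val x); rewrite ?invr_eq0.
move=> x y; rewrite !val_ovoid_perm.
case: (val x) (val y) => [[[a b] c]|] [[[a' b'] c']|] //=; rewrite !formE ?mulr0 //.
- by rewrite rr -/z !exprD expr1; ring.
- by rewrite divff // mulr1.
- by rewrite mulVf // mulr1.
Qed.

Lemma similitude_inv : similitude (inv_perm cardF).
Proof.
apply/similitudeP.
(* Inversion reverses the homogeneous coordinates, which preserves the form, and then divides by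
   [c]; the origin goes to infinity without rescaling. *)
exists (fun x => if val x is Some (a, b, c) then if c == 0 then 1 else c^-1 else 1).
  move=> x; case: (val x) => [[[a b] c]|]; last exact: oner_neq0.
  by case: (eqVneq c 0) => [_|c0]; rewrite ?oner_neq0 ?invr_neq0.
move=> x y; rewrite !val_ovoid_perm; move: (valP x) (valP y).
case: (val x) (val y) => [[[a b] c]|] [[[a' b'] c']|] /=.
- case: (eqVneq c 0) => [-> /eqP /(ovoid_c0 cardF)[-> ->]|c0 _].
    case: (eqVneq c' 0) => [-> /eqP /(ovoid_c0 cardF)[-> ->]|c'0 _].
      by rewrite !form_xx mulr0.
    by rewrite !formE !mul0r !addr0 mul1r mulVf.
  case: (eqVneq c' 0) => [-> /eqP /(ovoid_c0 cardF)[-> ->]|c'0 _].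
    by rewrite !formE !mulr0 !add0r mulr1 mulVf.
  by rewrite !formE; field; rewrite c0 c'0.
- move=> + _; case: (eqVneq c 0) => [-> _|c0 _]; rewrite !formE ?mulr1 //.
  by rewrite !mulr0 !add0r.
- move=> _; case: (eqVneq c' 0) => [-> _|c0 _]; rewrite !formE ?mulr1 ?mul1r //.
  by rewrite !mul0r !addr0.
- by move=> _ _; rewrite !form_xx mulr0.
Qed.

(** Reduces the claim on the Suzuki group to its generators. *)
Lemma similitude_group_set : group_set [set g | similitude g].
Proof.
apply/group_setP; split.
  rewrite inE; apply/similitudeP; exists (fun=> 1) => [x|x y].
    exact: oner_neq0.
  by rewrite !perm1 !mul1r.
move=> g g'; rewrite !inE => /similitudeP[k k0 kE] /similitudeP[k' k'0 k'E].
apply/similitudeP; exists (fun x => k' (g x) * k x) => [x|x y].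
  by rewrite mulf_neq0.
by rewrite !permM k'E kE; ring.
Qed.

Lemma suzuki_similitude g : g \in suzuki_group cardF -> similitude g.
Proof.
have /subsetP sub : suzuki_group cardF \subset Group similitude_group_set.
  rewrite gen_subG; apply/subsetP => x; rewrite !inE => /orP[/orP[|]|].
  - by case/imset2P => u v _ _ ->; exact: similitude_trans.
  - by case/imsetP => k _ ->; exact: similitude_diag.
  - by move/eqP->; exact: similitude_inv.
by move/sub; rewrite inE.
Qed.

Lemma form_frob (x y : omega) :
  form (val (frob_perm cardF x)) (val (frob_perm cardF y)) = form (val x) (val y) ^+ 2.
Proof.
have D (a b : F) : (a + b) ^+ 2 = a ^+ 2 + b ^+ 2.
  by rewrite sqrrD -mulr_natl two0 mul0r addr0.
rewrite !val_ovoid_perm.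
case: (val x) (val y) => [[[a b] c]|] [[[a' b'] c']|] //=; rewrite !formE ?expr1n ?expr0n //.
by rewrite !D !exprMn.
Qed.

(* Rescaled by the similitude factors, six common points would have the Gram
   matrix J - I, which is its own inverse in characteristic 2 and even size, so
   of rank 6, although the form lives on a space of dimension 4. *)
Lemma card_agreement_frob g : similitude g -> (#|agreement (frob_perm cardF) g| <= 5)%N.
Proof.
case/similitudeP => k k0 kE; rewrite leqNgt; apply/negP => lt5.
set S := agreement _ g in lt5.
pose p (i : 'I_6) : omega := enum_val (widen_ord lt5 i).
have pS i : frob_perm cardF (p i) = g (p i).
  by apply/eqP; have := enum_valP (widen_ord lt5 i); rewrite inE.
have p_inj : injective p by move=> i j /enum_val_inj /(congr1 val) /= /val_inj.
(* The form squared equals the form times the two factors; it is nonzero at distinct points, so it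
   cancels. *)
have formp i j : i != j -> form (val (p i)) (val (p j)) = k (p i) * k (p j).
  move=> ij; have f0 : form (val (p i)) (val (p j)) != 0.
    apply: contra ij => /eqP /(form_eq0 (valP _) (valP _)) /val_inj /p_inj ->.
    exact: eqxx.
  by apply: (mulIf f0); rewrite -expr2 -form_frob !pS kE.
(* [W'] reads the coordinates backwards, so [W *m W'] is the rescaled Gram matrix. *)
pose W : 'M[F]_(6, 4) := \matrix_(i, j) ((k (p i))^-1 * (coord (val (p i)))`_j).
pose W' : 'M[F]_(4, 6) := \matrix_(j, i) ((k (p i))^-1 * (coord (val (p i)))`_(rev_ord j)).
have gramE : W *m W' = const_mx 1 + 1%:M.
  apply/matrixP => i j; rewrite 3!mxE (eq_bigr (fun n : 'I_4 =>
    (k (p i))^-1 * (k (p j))^-1 *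
    ((coord (val (p i)))`_n * (coord (val (p j)))`_(rev_ord n)))); last first.
    by move=> n _; rewrite !mxE; ring.
  rewrite -mulr_sumr -/(form _ _) mxE; case: eqVneq => [->|ij].
    by rewrite form_xx mulr0 addxx.
  by rewrite formp // addr0; field; rewrite !k0.
have gram2 : (W *m W') *m (W *m W') = 1%:M.
  rewrite gramE mulmxDl !mulmxDr mulmx1 !mul1mx addrA.
  (* Each entry is 6 = 2 * 3, which vanishes. *)
  have -> : const_mx 1 *m (const_mx 1 : 'M[F]_6) = 0 :> 'M[F]_6.
    apply/matrixP => i j; rewrite !mxE.
    under eq_bigr do rewrite !mxE mulr1.
    by rewrite sumr_const card_ord (mulrnA 1 2 3) two0 mul0rn.
  rewrite add0r; apply/matrixP => i j.
  by rewrite !mxE addxx add0r.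
have := mxrank1 F 6; rewrite -gram2 => rk.
have : (\rank ((W *m W') *m (W *m W')) <= 4)%N.
  by rewrite -mulmxA; apply: leq_trans (mxrankM_maxl _ _) (rank_leq_col _).
by rewrite rk.
Qed.

End SymplecticForm.

(** * Regularity of the translations and the resulting distances *)

Section Distances.
Variables (m : nat) (F : finFieldType).
Hypothesis cardF : #|F| = suzuki_q m.
Local Notation l := (suzuki_l m).
Local Notation omega := (ovoid m F).
Local Notation translations := [set trans_perm cardF u v | u : F, v : F].

Definition ovoid_inf : omega := exist _ None isT.

Lemma trans_inf u v : trans_perm cardF u v ovoid_inf = ovoid_inf.
Proof. by apply: val_inj; rewrite val_ovoid_perm. Qed.

(** The ovoid equation determines the third coordinate, which later proofs therefore never
    compute. *)
Lemma ovoid_ext (x y : omega) a b c c' :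
  val x = Some (a, b, c) -> val y = Some (a, b, c') -> x = y.
Proof.
move=> ex ey; apply: val_inj; move: (valP x) (valP y).
by rewrite ex ey /= => /eqP-> /eqP->.
Qed.

Lemma ovoid_fin (x : omega) : x != ovoid_inf -> exists a b c, val x = Some (a, b, c).
Proof.
case e: (val x) => [[[a b] c]|]; first by exists a, b, c.
by case/eqP; apply: val_inj.
Qed.

Lemma trans_perm_inj u v u' v' (x : omega) : x != ovoid_inf ->
  trans_perm cardF u v x = trans_perm cardF u' v' x -> u = u' /\ v = v'.
Proof.
case/ovoid_fin => a [b [c ex]] /(congr1 val).
by rewrite !val_ovoid_perm ex /= => -[/addrI-> /addIr/addrI-> _].
Qed.

Lemma trans_perm_trans (x y : omega) : x != ovoid_inf -> y != ovoid_inf ->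
  exists u v, trans_perm cardF u v x = y.
Proof.
move=> /ovoid_fin[a [b [c ex]]] /ovoid_fin[a' [b' [c' ey]]].
(* The second parameter compensates for the shear term [u ^+ l * a]. *)
exists (a' - a), (b' - b - (a' - a) ^+ l * a).
set t := trans_perm _ _ _.
have : val (t x) = trans_fun m (a' - a) (b' - b - (a' - a) ^+ l * a) (val x).
  exact: val_ovoid_perm.
rewrite ex /=; set c1 := (c + _ + _ + _ + _ + _ + _).
have -> : a + (a' - a) = a' by ring.
have -> : b + (b' - b - (a' - a) ^+ l * a) + (a' - a) ^+ l * a = b' by ring.
by move=> /ovoid_ext; apply; exact: ey.
Qed.

Lemma translations_regular (x y : omega) : x != ovoid_inf -> y != ovoid_inf ->
  #|[set t in translations | t x == y]| = 1%N.
Proof.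
move=> xo yo; have [u [v uvE]] := trans_perm_trans xo yo.
rewrite -(cards1 (trans_perm cardF u v)); apply: eq_card => t; rewrite !inE.
apply/andP/eqP => [[/imset2P[u' v' _ _ ->]]|->]; last by rewrite uvE imset2_f.
by rewrite -uvE => /eqP /(trans_perm_inj xo)[-> ->].
Qed.

Lemma trans_perm1 : trans_perm cardF 0 0 = 1%g.
Proof.
apply/permP => x; apply: val_inj; rewrite val_ovoid_perm perm1.
case: (val x) => [[[a b] c]|] //=.
by rewrite exprD (expr0_l m) !exprD !mul0r !expr1 !mulr0 !mul0r !addr0.
Qed.

Lemma origin_on_ovoid : on_ovoid m (Some (0, 0, 0) : option (F * F * F)).
Proof. by rewrite /= exprD (expr0_l m) !mul0r !addr0. Qed.

Definition origin : omega := exist _ (Some (0, 0, 0)) origin_on_ovoid.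

Lemma card_translations : #|translations| = (suzuki_q m ^ 2)%N.
Proof.
have -> : translations = [set trans_perm cardF p.1 p.2 | p : F * F].
  apply/setP => t; apply/imset2P/imsetP => [[u v _ _ ->]|[[u v] _ ->]].
    by exists (u, v).
  by exists u v.
rewrite card_imset ?card_prod ?cardF // => -[u v] [u' v'] /= /(congr1 (fun t : {perm omega} => t origin)).
by case/trans_perm_inj => // -> ->.
Qed.

Lemma suzuki_transitive x : exists2 g, g \in suzuki_group cardF & g ovoid_inf = x.
Proof.
have [->|xo] := eqVneq x ovoid_inf.
  by exists 1%g; rewrite ?group1 ?perm1.
have [u [v uvE]] := @trans_perm_trans origin x isT xo.
(* The left factor acts first: infinity goes to the origin, then to [x]. *)
exists (inv_perm cardF * trans_perm cardF u v)%g.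
  by rewrite groupM // mem_gen // !inE ?imset2_f ?eqxx ?orbT.
rewrite permM -uvE; congr (_ _); apply: val_inj.
by rewrite val_ovoid_perm.
Qed.

Lemma covering_radius_suzuki_le :
  (covering_radius (suzuki_group cardF) <= suzuki_q m ^ 2 - 2)%N.
Proof.
have cT : #|omega| = #|translations|.+1.
  by rewrite card_translations card_ovoid // addn1.
(* Rewrites q^2 - 2 as (q^2 + 1) - 3. *)
rewrite -card_translations -subSS -cT.
apply: (@covering_radius_le _ _ translations ovoid_inf) => //.
- exact: suzuki_transitive.
- by apply/subsetP => t tA; rewrite mem_gen // !inE tA.
- by rewrite -trans_perm1 imset2_f.
- by rewrite card_translations oddX oddX addn1.
- by move=> t /imset2P[u v _ _ ->]; exact: trans_inf.
- exact: translations_regular.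
Qed.

Lemma card_fix_frob : (5 <= #|agreement (frob_perm cardF) 1|)%N.
Proof.
(* Booleans stand for the elements 0 and 1 of the prime field, fixed by squaring. *)
pose f (z : option (bool * bool)) : omega :=
  if z is Some (a, b) then trans_perm cardF a%:R b%:R origin else ovoid_inf.
have f_fin a b : exists c, val (f (Some (a, b))) = Some (a%:R, b%:R, c).
  by rewrite /f val_ovoid_perm /= !mulr0 !addr0 !add0r; eexists.
have f_inj : injective f.
  move=> [[a b]|] [[a' b']|] //.
  - have bool_inj (d d' : bool) : d%:R = d'%:R :> F -> d = d'.
      by case: d d' => [] [] //= /eqP; rewrite ?oner_eq0 // eq_sym oner_eq0.
    have [c e] := f_fin a b; have [c' e'] := f_fin a' b'.
    move/(congr1 val); rewrite e e' => -[aE bE _].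
    by rewrite (bool_inj _ _ aE) (bool_inj _ _ bE).
  - by have [c e] := f_fin a b => /(congr1 val); rewrite e.
  - by have [c e] := f_fin a' b' => /(congr1 val); rewrite e.
have -> : 5%N = #|[set f z | z in predT]|.
  by rewrite card_imset // card_option card_prod card_bool.
apply: subset_leq_card; apply/subsetP => _ /imsetP[z _ ->]; rewrite inE perm1.
apply/eqP; case: z => [[a b]|]; last by apply: val_inj; rewrite val_ovoid_perm.
have [c e] := f_fin a b.
apply: (@ovoid_ext _ _ a%:R b%:R (c ^+ 2) c) => //.
by rewrite val_ovoid_perm e /=; case: a b {e} => [] []; rewrite ?expr1n ?expr0n.
Qed.

Lemma dist_to_frob :
  dist_to (frob_perm cardF) (suzuki_group cardF) = (suzuki_q m ^ 2 - 4)%N.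
Proof.
apply/eqP; rewrite eqn_leq; apply/andP; split.
  apply: leq_trans (dist_to_le _ (group1 _)) _.
  rewrite hamming_distE (card_ovoid cardF).
  by apply: leq_trans (leq_sub2l _ card_fix_frob) _; rewrite addn1 subSS.
apply: leq_dist_to => [|g gG]; first by rewrite (card_ovoid cardF); lia.
rewrite hamming_distE (card_ovoid cardF).
have := leq_sub2l (suzuki_q m ^ 2 + 1) (card_agreement_frob cardF (suzuki_similitude gG)).
by rewrite addn1 subSS.
Qed.

End Distances.

Theorem theorem1p3 (m : nat) (F : finFieldType) (cardF : #|F| = suzuki_q m) :
  [/\ suzuki_q m ^ 2 - 4 <= covering_radius (suzuki_group cardF),
      covering_radius (suzuki_group cardF) <= suzuki_q m ^ 2 - 2
    & dist_to (frob_perm cardF) (suzuki_group cardF) = suzuki_q m ^ 2 - 4]%N.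
Proof.
split; [|exact: covering_radius_suzuki_le | exact: dist_to_frob].
(* The Frobenius map witnesses the lower bound. *)
by rewrite -(dist_to_frob cardF); exact: leq_bigmax.
Qed.
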